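(* For every positive integer $n$, $$\overline{A}_{25}(5n)\equiv \sigma_3^-(n) \pmod{5},$$ where $\sigma_3^-(n)=\sum_{d\mid n}(-1)^d d^3$ (sum over positive divisors $d$ of $n$).
   Context: An overpartition of $n$ is a partition of $n$ in which the first occurrence of each distinct part may be overlined. For a positive integer $\ell$, $\overline{A}_\ell(n)$ denotes the number of overpartitions of $n$ into parts not divisible by $\ell$, with $\overline{A}_\ell(0)=1$; equivalently $$\sum_{n\ge 0}\overline{A}_\ell(n)q^n=\frac{(q^\ell;q^\ell)_\infty^2(q^2;q^2)_\infty}{(q;q)_\infty^2(q^{2\ell};q^{2\ell})_\infty},\qquad (a;q)_\infty=\prod_{k\ge 0}(1-aq^k).$$ *)

(* Defs.v *)
From mathcomp Require Import all_boot all_order all_algebra.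

Set Implicit Arguments.
Unset Strict Implicit.
Unset Printing Implicit Defensive.

Import GRing.Theory.

(* A list of pairs (part, is this occurrence overlined?), parts in weakly
   decreasing order. [index p ps == i] says that position i is the first
   occurrence of p in ps. *)
Definition is_overpartition (n : nat) (s : seq (nat * bool)) : bool :=
  let ps := unzip1 s in
  [&& sorted geq ps, all (ltn 0) ps, sumn ps == n &
      all (fun i => nth false (unzip2 s) i ==> (index (nth 0 ps i) ps == i))
          (iota 0 (size s))].

Definition op_val (n : nat) (s : n.-bseq ('I_n.+1 * bool)) : seq (nat * bool) :=
  [seq (nat_of_ord x.1, x.2) | x <- s].

(* The carrier only provides finiteness: an overpartition of n has at most n
   parts, each at most n (see op_val_inj and op_val_surj). *)
Definition overpartitions (n : nat) : {set n.-bseq ('I_n.+1 * bool)} :=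
  [set s | is_overpartition n (op_val s)].

Definition Abar (l n : nat) : nat :=
  #|[set s in overpartitions n | all (fun p => ~~ (l %| p)) (unzip1 (op_val s))]|.

Definition sigma3m (n : nat) : int :=
  (\sum_(d <- divisors n) (-1) ^+ d * (d%:Z) ^+ 3)%R.

Lemma op_val_inj n : injective (@op_val n).
Proof.
move=> s t st; apply/val_inj; move: st; rewrite /op_val.
apply: inj_map => -[i a] [j b] /= [ij ->]; congr (_, _); exact/val_inj.
Qed.

Lemma op_val_surj n (s : seq (nat * bool)) :
  is_overpartition n s -> exists2 t, t \in overpartitions n & op_val t = s.
Proof.
move=> os; have /and4P[_ pos /eqP sn _] := os.
have sz : size s <= n.
  rewrite -sn; elim: s pos {os sn} => //= x s IH /andP[x0 /IH].
  by rewrite -add1n; apply: leq_add.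
have le : all (fun x : nat * bool => x.1 <= n) s.
  rewrite -sn; apply/allP => x xs; elim: s xs {os sn pos sz} => //= y s IH.
  rewrite inE => /predU1P[->|/IH h]; first exact: leq_addr.
  exact: leq_trans h (leq_addl _ _).
pose t := [seq (inord x.1 : 'I_n.+1, x.2) | x <- s].
have st : size t <= n by rewrite size_map.
have ts : op_val (Bseq st) = s.
  rewrite /op_val /= /t -map_comp; apply: map_id_in => -[i b] /(allP le) /= h.
  by rewrite inordK.
by exists (Bseq st) => //; rewrite inE ts.
Qed.

(* Main.v *)
Require Import Defs.
From mathcomp Require Import all_boot all_order all_algebra.
From mathcomp Require Import zify ring.

Set Implicit Arguments.
Unset Strict Implicit.
Unset Printing Implicit Defensive.

Import GRing.Theory.

(**
Let F(q) = prod_k (1 - q^k) / (1 + q^k). The generating function of Abar 25 is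
F(q^25) / F(q), which is F^24 over F_5. Put
  T = sum_(d,e >= 1) (-1)^(d+e) d q^(de),   S = sum_(d,e >= 1, e odd) d q^(de),
  Z = sum_(d,e >= 1) (-1)^d d^3 q^(de),     G = 1 - 8 T.
Two convolution identities of Liouville type, q T' = S G and 4 T^2 = Z + T, are
proved by rearranging the solutions of a x + b y = n. As q F' / F = - 2 S, the
first one gives F^4 = G (both sides have the same logarithmic derivative), and
the second one gives G^2 = 1 + 16 Z. Over F_5 we get F^24 = G^6 = G(q^5) G(q),
and the coefficients of G satisfy G_(5m) = G_m, so the coefficient of q^(5n) in
F^24 is that of q^n in G^2, which is 16 sigma3m n = sigma3m n.
Power series are polynomials modulo 'X^(N + 1).
*)

Local Open Scope ring_scope.

Local Notation sg k := ((-1) ^+ k%N : int).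
Local Notation par k := (((odd k%N) : nat)%:Z).

(** * Sums over the solutions of a x + b y = n *)

Lemma big_seq_bij (R : Type) (idx : R) (op : Monoid.com_law idx)
    (T U : eqType) (s : seq T) (t : seq U) (P : pred T) (Q : pred U)
    (f : T -> U) (g : U -> T) (w : T -> R) (w' : U -> R) :
  uniq s -> uniq t ->
  (forall x : T, x \in s -> P x ->
     [/\ f x \in t, Q (f x), g (f x) = x & w x = w' (f x)]) ->
  (forall y, y \in t -> Q y -> [/\ g y \in s, P (g y) & f (g y) = y]) ->
  \big[op/idx]_(x <- s | P x) w x = \big[op/idx]_(y <- t | Q y) w' y.
Proof.
move=> us ut fP gP.
rewrite big_seq_cond.
rewrite (eq_bigr (fun x => w' (f x))); last first.
  by move=> x /andP[xs Px]; have [] := fP x xs Px.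
rewrite -big_seq_cond -big_filter -[RHS]big_filter -(big_map f xpredT w').
apply: perm_big; apply: uniq_perm.
- rewrite map_inj_in_uniq ?filter_uniq // => x y.
  rewrite !mem_filter => /andP[Px xs] /andP[Py ys] e.
  have [_ _ <- _] := fP x xs Px; have [_ _ <- _] := fP y ys Py.
  by rewrite e.
- exact: filter_uniq.
move=> y; apply/mapP/idP => [[x]|].
  rewrite !mem_filter => /andP[Px xs] ->.
  by have [-> -> _ _] := fP x xs Px.
rewrite mem_filter => /andP[Qy yt]; exists (g y).
  by rewrite mem_filter; have [-> -> _] := gP y yt Qy.
by have [_ _ ->] := gP y yt Qy.
Qed.

Arguments big_seq_bij {R idx op T U s t P Q} f g {w w'}.

Definition rect (N : nat) : seq (nat * nat) :=
  [seq (d, e) | d <- iota 1 N, e <- iota 1 N].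

Lemma rect_uniq N : uniq (rect N).
Proof.
by apply: allpairs_uniq; rewrite ?iota_uniq // => -[a b] [c d] _ _ [-> ->].
Qed.

Lemma mem_rect N d e : ((d, e) \in rect N) = (0 < d <= N)%N && (0 < e <= N)%N.
Proof.
apply/allpairsP/andP => [[[a b] /= []]|[hd he]].
  by rewrite !mem_iota add1n !ltnS => ha hb [-> ->].
by exists (d, e); rewrite /= !mem_iota add1n !ltnS.
Qed.

(** An element [((a, x), (b, y))] is a solution of [a x + b y = n]. For [n <= N] the box is no
    restriction, as every entry is at most [n]; a single [N] can thus serve all degrees up to
    [N]. *)
Definition quads (N n : nat) : seq ((nat * nat) * (nat * nat)) :=
  [seq q <- [seq (p, p') | p <- rect N, p' <- rect N]
     | (q.1.1 * q.1.2 + q.2.1 * q.2.2 == n)%N].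

Lemma quads_uniq N n : uniq (quads N n).
Proof.
apply: filter_uniq; apply: allpairs_uniq; rewrite ?rect_uniq //.
by move=> [a b] [c d] _ _ [-> ->].
Qed.

Lemma mem_quads N n a x b y : (n <= N)%N ->
  (((a, x), (b, y)) \in quads N n) =
  [&& 0 < a, 0 < x, 0 < b, 0 < y & a * x + b * y == n]%N.
Proof.
move=> nN; rewrite mem_filter /= andbC.
apply/andP/and5P => [[/allpairsP[[[c z] [d t]] /= []]]|[a0 x0 b0 y0 /eqP e]].
  rewrite !mem_rect => /andP[/andP[h1 _] /andP[h2 _]].
  by move=> /andP[/andP[h3 _] /andP[h4 _]] [-> -> -> ->] ->.
split; last exact/eqP.
apply/allpairsP; exists ((a, x), (b, y)); split => //=; rewrite mem_rect; nia.
Qed.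

Definition dsum (N n : nat) (w : nat -> nat -> int) : int :=
  \sum_(p <- rect N | (p.1 * p.2 == n)%N) w p.1 p.2.

Definition qsum (N n : nat) (P : nat -> nat -> nat -> nat -> bool)
    (w : nat -> nat -> nat -> nat -> int) : int :=
  \sum_(q <- quads N n | P q.1.1 q.1.2 q.2.1 q.2.2)
     w q.1.1 q.1.2 q.2.1 q.2.2.

Section LiouvilleSums.
Variables (N n : nat).
Hypothesis nN : (n <= N)%N.
Local Notation qs := (qsum N n).
Local Notation ds := (dsum N n).

Lemma eq_qsum (P : nat -> nat -> nat -> nat -> bool) w w' :
  (forall a x b y, P a x b y -> w a x b y = w' a x b y) ->
  qs P w = qs P w'.
Proof. by move=> h; apply: eq_bigr => q /h. Qed.

Lemma eq_dsum w w' :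
  (forall d e, (0 < d)%N -> (0 < e)%N -> (d * e)%N = n -> w d e = w' d e) ->
  ds w = ds w'.
Proof.
move=> h; rewrite /dsum big_seq_cond [RHS]big_seq_cond.
apply: eq_bigr => -[d e]; rewrite mem_rect /=.
by move=> /andP[/andP[/andP[d0 _] /andP[e0 _]] /eqP]; apply: h.
Qed.

Lemma qsum_swap P w :
  qs P w = qs (fun a x b y => P b y a x) (fun a x b y => w b y a x).
Proof.
apply: (big_seq_bij (fun q => (q.2, q.1)) (fun q => (q.2, q.1)));
  rewrite ?quads_uniq // => -[[a x] [b y]] /=; rewrite !mem_quads // => h ->;
  split=> //; lia.
Qed.

(** Rests on [(a + b) x + b y = a x + b (x + y)]: subtracting [b] from the first entry and adding
    [x] to the last turns the solutions with [b < a] into those with [x < y]. *)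
Lemma qsum_shear w w' :
  (forall a x b y, w (a + b)%N x b y = w' a x b (x + y)%N) ->
  qs (fun a x b y => b < a)%N w = qs (fun a x b y => x < y)%N w'.
Proof.
move=> h.
apply: (big_seq_bij
  (fun q => ((q.1.1 - q.2.1, q.1.2), (q.2.1, q.1.2 + q.2.2))%N)
  (fun q => ((q.1.1 + q.2.1, q.1.2), (q.2.1, q.2.2 - q.1.2))%N));
  rewrite ?quads_uniq // => -[[a x] [b y]] /=; rewrite !mem_quads //.
  move=> /and5P[a0 x0 b0 y0 /eqP e] ba.
  have [c ec] : exists c, a = (c + b)%N by exists (a - b)%N; lia.
  by subst a; rewrite addnK addKn -h; split=> //; nia.
move=> /and5P[a0 x0 b0 y0 /eqP e] xy.
have [c ec] : exists c, y = (x + c)%N by exists (y - x)%N; lia.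
by subst y; rewrite addnK addKn; split=> //; nia.
Qed.

(** The mirror image, from [a x + (a + b) y = a (x + y) + b y]. *)
Lemma qsum_shear' w w' :
  (forall a x b y, w a x (a + b)%N y = w' a (x + y)%N b y) ->
  qs (fun a x b y => a < b)%N w = qs (fun a x b y => y < x)%N w'.
Proof.
move=> h; rewrite qsum_swap [RHS]qsum_swap; apply: qsum_shear => a x b y.
by rewrite addnC h addnC.
Qed.

Lemma qsum_split (c : nat -> nat -> nat -> nat -> nat * nat) w :
  qs (fun _ _ _ _ => true) w =
  qs (fun a x b y => (c a x b y).1 < (c a x b y).2)%N w +
  qs (fun a x b y => (c a x b y).2 < (c a x b y).1)%N w +
  qs (fun a x b y => (c a x b y).1 == (c a x b y).2)%N w.
Proof.
rewrite /qsum big_mkcond [X in X + _ + _]big_mkcond [X in _ + X + _]big_mkcond.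
rewrite [X in _ + X]big_mkcond -!big_split; apply: eq_bigr => -[[a x] [b y]] _ /=.
by case: ltngtP => _; rewrite ?addr0 ?add0r.
Qed.

(** For [x = y = e] the equation is [(a + b) e = n]: a factorisation [d e = n] together with a
    splitting [d = c + (d - c)]. *)
Lemma qsum_diag w :
  qs (fun a x b y => x == y) w =
  ds (fun d e => \sum_(1 <= c < d) w c e (d - c)%N e).
Proof.
rewrite /dsum.
rewrite -big_filter.
pose F (pc : nat * nat * nat) := w pc.2 pc.1.2 (pc.1.1 - pc.2)%N pc.1.2.
rewrite -[RHS](big_allpairs_dep (h := fun (p : nat * nat) (c : nat) => (p, c))
  (r2 := fun p => index_iota 1 p.1) (F := F)).
apply: (big_seq_bij
  (fun q => ((q.1.1 + q.2.1, q.1.2), q.1.1)%N)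
  (fun q => ((q.2, q.1.2), (q.1.1 - q.2, q.1.2))%N)).
- exact: quads_uniq.
- apply: allpairs_uniq_dep; rewrite ?filter_uniq ?rect_uniq //.
    by move=> *; apply: iota_uniq.
  by move=> [p c] [p' c'] _ _ /= [-> ->].
- move=> [[a x] [b y]]; rewrite mem_quads //= => /and5P[a0 x0 b0 y0 /eqP e] /eqP xy.
  subst y; split=> //; last by rewrite /F /= addKn.
    apply/allpairsPdep; exists (a + b, x)%N, a; split=> //=.
      rewrite mem_filter mem_rect /=; nia.
    rewrite mem_index_iota; lia.
  by rewrite addKn.
move=> [[d e] c] /allpairsPdep[[d' e'] [c' []]] /=.
rewrite mem_filter mem_rect /= mem_index_iota => h1 h2 [-> -> ->] _.
split; rewrite ?eqxx // ?mem_quads //; first nia.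
rewrite subnKC //; lia.
Qed.

(** Follows from [qsum_diag] by exchanging the entries within each pair, which keeps the
    products. *)
Lemma qsum_diag' w :
  qs (fun a x b y => a == b) w =
  ds (fun d e => \sum_(1 <= z < e) w d z d (e - z)%N).
Proof.
pose tr (p : nat * nat) := (p.2, p.1).
rewrite -[LHS]/(\sum_(q <- quads N n | q.1.1 == q.2.1) w q.1.1 q.1.2 q.2.1 q.2.2).
have -> : ds (fun d e => \sum_(1 <= z < e) w d z d (e - z)%N) =
          ds (fun d e => \sum_(1 <= z < d) w e z e (d - z)%N).
  apply: (big_seq_bij tr tr);
    rewrite ?rect_uniq // => -[d e]; rewrite /= mem_rect => h1 h2;
    rewrite /tr mem_rect /=; split=> //; lia.
rewrite -(qsum_diag (fun a x b y => w x a y b)).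
apply: (big_seq_bij (fun q => (tr q.1, tr q.2)) (fun q => (tr q.1, tr q.2)));
  rewrite ?quads_uniq // => -[[a x] [b y]]; rewrite /= mem_quads // => h1 h2;
  rewrite /tr mem_quads //=; split=> //; lia.
Qed.

Lemma dsumD w w' : ds w + ds w' = ds (fun d e => w d e + w' d e).
Proof. by rewrite /dsum big_split. Qed.

Lemma dsumZ c w : c * ds w = ds (fun d e => c * w d e).
Proof. by rewrite /dsum big_distrr. Qed.

Lemma qsumD P w w' :
  qs P w + qs P w' = qs P (fun a x b y => w a x b y + w' a x b y).
Proof. by rewrite /qsum big_split. Qed.

Lemma qsumZ P c w : c * qs P w = qs P (fun a x b y => c * w a x b y).
Proof. by rewrite /qsum big_distrr. Qed.

End LiouvilleSums.

(** * Two convolution identities *)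

Lemma sign_odd (k : nat) : sg k = 1 - 2 * par k.
Proof. by rewrite -signr_odd; case: (odd k). Qed.

(** Signs depend only on parities; after a case split on these a polynomial identity remains. *)
Ltac parity :=
  rewrite ?sign_odd ?oddD;
  repeat match goal with |- context [odd ?k] => case: (odd k) end;
  rewrite /=; ring.

Lemma sign_sub (m k : nat) : (k <= m)%N -> sg (m - k) = sg (m + k).
Proof. by move=> h; rewrite -signr_odd -[RHS]signr_odd oddB // oddD. Qed.

Lemma sum_sign (d : nat) :
  (0 < d)%N -> \sum_(1 <= c < d) sg c = par d - 1.
Proof.
case: d => // d _; elim: d => [|d IH]; first by rewrite big_geq.
by rewrite big_nat_recr //= IH -signr_odd /=; case: (odd d).
Qed.

Lemma sum_sign_sqr (d : nat) : (0 < d)%N ->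
  2 * \sum_(1 <= c < d) sg c * c%:Z ^+ 2 = - sg d * (d%:Z ^+ 2 - d%:Z).
Proof.
case: d => // d _; elim: d => [|d IH]; first by rewrite big_geq // expr1; ring.
by rewrite big_nat_recr //= mulrDr IH !exprS -natr1 !natz; ring.
Qed.

Lemma sum_odd (d : nat) : (0 < d)%N ->
  2 * \sum_(1 <= c < d) par c = d%:Z - par d.
Proof.
case: d => // d _; elim: d => [|d IH]; first by rewrite big_geq.
by rewrite big_nat_recr //= mulrDr IH /=; case: (odd d) => /=; lia.
Qed.

Section Convolutions.
Variables (N n : nat).
Hypothesis nN : (n <= N)%N.
Local Notation qs := (qsum N n).
Local Notation ds := (dsum N n).
Local Notation all4 := (fun _ _ _ _ : nat => true).

(** This is [4 T^2 = Z + T] in degree [n]. As [4 a b = (a + b)^2 - (a - b)^2], the left side is the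
    sum of [A] minus the sum of [B]. Shears turn the off-diagonal parts of both into sums of [H],
    and in the end only the diagonals [x = y] and [a = b] survive. *)
Lemma convolution_sign_sign :
  4 * qs all4 (fun a x b y => (sg (a + x) * a%:Z) * (sg (b + y) * b%:Z)) =
  ds (fun d e => sg d * d%:Z ^+ 3) + ds (fun d e => sg (d + e) * d%:Z).
Proof.
pose A a x b y : int := sg (a + x + b + y) * (a%:Z + b%:Z) ^+ 2.
pose B a x b y : int := sg (a + x + b + y) * (a%:Z - b%:Z) ^+ 2.
pose H a (x b : nat) y : int := sg (a + y) * a%:Z ^+ 2.
have -> : 4 * qs all4 (fun a x b y => (sg (a + x) * a%:Z) * (sg (b + y) * b%:Z))
          = qs all4 A - qs all4 B.
  rewrite qsumZ -[- qs _ B]mulN1r qsumZ qsumD; apply: eq_qsum => a x b y _.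
  by rewrite /A /B !exprD; ring.
rewrite (qsum_split _ _ (fun a x b y => (x, y)) A).
rewrite (qsum_split _ _ (fun a x b y => (a, b)) B) /=.
have A1 : qs (fun a x b y => x < y)%N A = qs (fun a x b y => b < a)%N H.
  by symmetry; apply: qsum_shear => // a x b y; rewrite /A /H PoszD; parity.
have A2 : qs (fun a x b y => y < x)%N A = qs (fun a x b y => b < a)%N H.
  by rewrite -A1 qsum_swap //; apply: eq_qsum => a x b y _; rewrite /A; parity.
have B1 : qs (fun a x b y => b < a)%N B = qs (fun a x b y => x < y)%N H.
  by apply: qsum_shear => // a x b y; rewrite /B /H PoszD; parity.
have B2 : qs (fun a x b y => a < b)%N B = qs (fun a x b y => x < y)%N H.
  by rewrite -B1 qsum_swap //; apply: eq_qsum => a x b y _; rewrite /B; parity.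
have B3 : qs (fun a x b y => a == b)%N B = 0.
  by apply: big1 => -[[a x] [b y]] /= /eqP ->; rewrite /B; ring.
have HH : qs (fun a x b y => a < b)%N H = qs (fun a x b y => y < x)%N H.
  exact: qsum_shear'.
(* Splitting the sum of [H] in two ways and cancelling by [HH] compares the part [b < a], which came
   from [A], with the part [x < y], which came from [B]: they differ by diagonal sums. *)
have := qsum_split N n (fun a x b y => (x, y)) H.
rewrite (qsum_split _ _ (fun a x b y => (a, b)) H) /= HH.
have dA : qs (fun a x b y => x == y) A =
          ds (fun d e => sg d * (d%:Z ^+ 3 - d%:Z ^+ 2)).
  rewrite qsum_diag //; apply: eq_dsum => // d e d0 e0 _.
  rewrite (eq_big_nat _ _ (F2 := fun _ => sg d * d%:Z ^+ 2)) => [|c /andP[c1 cd]].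
    rewrite sumr_const_nat -mulr_natr natrB // natz; ring.
  rewrite /A -PoszD subnKC 1?ltnW // !exprD sign_sub 1?ltnW // exprD.
  parity.
have dH : qs (fun a x b y => x == y) H *2 =
          ds (fun d e => - sg (d + e) * (d%:Z ^+ 2 - d%:Z)).
  rewrite mulrC qsum_diag // dsumZ; apply: eq_dsum => // d e d0 e0 _.
  rewrite exprD -mulNr mulrAC -sum_sign_sqr // -mulrA big_distrl /=.
  congr (_ * _); apply: eq_big_nat => c _; rewrite /H exprD; ring.
have dH' : qs (fun a x b y => a == b) H =
          ds (fun d e => sg (d + e) * d%:Z ^+ 2 * (par e - 1)).
  rewrite qsum_diag' //; apply: eq_dsum => // d e d0 e0 _.
  rewrite -sum_sign // big_distrr /=; apply: eq_big_nat => z /andP[z0 ze].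
  rewrite /H exprD sign_sub 1?ltnW // !exprD; ring.
have -> : ds (fun d e => sg d * d%:Z ^+ 3) + ds (fun d e => sg (d + e) * d%:Z) =
  ds (fun d e => sg d * (d%:Z ^+ 3 - d%:Z ^+ 2)) + 
  ds (fun d e => - sg (d + e) * (d%:Z ^+ 2 - d%:Z)) 
  - 2 * ds (fun d e => sg (d + e) * d%:Z ^+ 2 * (par e - 1)).
  rewrite -mulNr dsumZ !dsumD; apply: eq_dsum => // d e _ _ _; parity.
rewrite -dA -dH -dH' A1 A2 B1 B2 B3; lia.
Qed.

(** This is [8 S T = S - q T'] in degree [n], that is [q T' = S G]. The method is the same, but the
    weight is not symmetric in the two pairs, so the shears lead to two weights [K] and [L], which
    [qsum_shear'] exchanges up to sign. *)
Lemma convolution_odd_sign :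
  8 * qs all4 (fun a x b y => (par x * a%:Z) * (sg (b + y) * b%:Z)) =
  ds (fun d e => par e * d%:Z) - n%:Z * ds (fun d e => sg (d + e) * d%:Z).
Proof.
pose A a x b y : int := par x * sg (b + y) * (a%:Z + b%:Z) ^+ 2.
pose B a x b y : int := par x * sg (b + y) * (a%:Z - b%:Z) ^+ 2.
pose K a x b y : int := par x * sg (b + y) * a%:Z ^+ 2.
pose L a x b y : int := par (x + y) * sg (a + b + x) * a%:Z ^+ 2.
have -> : 8 * qs all4 (fun a x b y => (par x * a%:Z) * (sg (b + y) * b%:Z))
          = 2 * (qs all4 A - qs all4 B).
  rewrite -[- qs _ B]mulN1r !qsumZ qsumD qsumZ; apply: eq_qsum => a x b y _.
  by rewrite /A /B; ring.
rewrite (qsum_split _ _ (fun a x b y => (x, y)) A).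
rewrite (qsum_split _ _ (fun a x b y => (a, b)) B) /=.
have A1 : qs (fun a x b y => x < y)%N A = - 1 * qs (fun a x b y => b < a)%N K.
  rewrite qsumZ; symmetry.
  by apply: qsum_shear => // a x b y; rewrite /A /K PoszD; parity.
have A2 : qs (fun a x b y => y < x)%N A = qs (fun a x b y => b < a)%N L.
  rewrite qsum_swap //; symmetry.
  by apply: qsum_shear => // a x b y; rewrite /A /L PoszD; parity.
have B1 : qs (fun a x b y => b < a)%N B = -1 * qs (fun a x b y => x < y)%N K.
  by rewrite qsumZ; apply: qsum_shear => // a x b y; rewrite /B /K PoszD; parity.
have B2 : qs (fun a x b y => a < b)%N B = qs (fun a x b y => x < y)%N L.
  rewrite qsum_swap //.
  by apply: qsum_shear => // a x b y; rewrite /B /L PoszD; parity.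
have B3 : qs (fun a x b y => a == b)%N B = 0.
  by apply: big1 => -[[a x] [b y]] /= /eqP ->; rewrite /B; ring.
have KL : qs (fun a x b y => a < b)%N K = -1 * qs (fun a x b y => y < x)%N L.
  by rewrite qsumZ; apply: qsum_shear' => // a x b y; rewrite /K /L; parity.
have LK : qs (fun a x b y => a < b)%N L = -1 * qs (fun a x b y => y < x)%N K.
  by rewrite qsumZ; apply: qsum_shear' => // a x b y; rewrite /K /L; parity.
(* In the difference of the two splittings below, the sums of [K] and [L] over [y < x] cancel. *)
have := qsum_split N n (fun a x b y => (x, y)) K.
rewrite (qsum_split _ _ (fun a x b y => (a, b)) K) /=.
have := qsum_split N n (fun a x b y => (x, y)) L.
rewrite (qsum_split _ _ (fun a x b y => (a, b)) L) /= KL LK.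
have dA : qs (fun a x b y => x == y) A =
          ds (fun d e => par e * sg (d + e) * d%:Z ^+ 2 * (par d - 1)).
  rewrite qsum_diag //; apply: eq_dsum => // d e d0 e0 _.
  rewrite -sum_sign // big_distrr /=; apply: eq_big_nat => c /andP[c1 cd].
  by rewrite /A -PoszD subnKC 1?ltnW // !exprD sign_sub 1?ltnW // exprD; ring.
have dK : 2 * qs (fun a x b y => x == y) K =
          ds (fun d e => par e * sg (d + e) * (- sg d * (d%:Z ^+ 2 - d%:Z))).
  rewrite qsum_diag // dsumZ; apply: eq_dsum => // d e d0 e0 _.
  rewrite -sum_sign_sqr // mulrCA; congr (_ * _).
  rewrite big_distrr /=; apply: eq_big_nat => c /andP[c1 cd].
  by rewrite /K !exprD sign_sub 1?ltnW // exprD; ring.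
(* The term linear in [e] is the source of the factor [n], since [d^2 e = n d] when [d e = n]. *)
have dK' : 2 * qs (fun a x b y => a == b) K =
          ds (fun d e => - (sg (d + e) * d%:Z ^+ 2) * (e%:Z - par e)).
  rewrite qsum_diag' // dsumZ; apply: eq_dsum => // d e d0 e0 _.
  rewrite -sum_odd // mulrCA; congr (_ * _).
  rewrite big_distrr /=; apply: eq_big_nat => z /andP[z0 ze].
  by rewrite /K exprD sign_sub 1?ltnW // !exprD -[sg z]signr_odd; case: (odd z) => /=; ring.
have dL : qs (fun a x b y => x == y) L = 0.
  by apply: big1 => -[[a x] [b y]] /= /eqP ->; rewrite /L oddD addbb !mul0r.
have dL' : qs (fun a x b y => a == b) L =
          ds (fun d e => par e * d%:Z ^+ 2 * (par e - 1)).
  rewrite qsum_diag' //; apply: eq_dsum => // d e d0 e0 _.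
  rewrite -sum_sign // big_distrr /=; apply: eq_big_nat => z /andP[z0 ze].
  by rewrite /L subnKC 1?ltnW //; parity.
have -> : ds (fun d e => par e * d%:Z) - n%:Z * ds (fun d e => sg (d + e) * d%:Z) =
  2 * ds (fun d e => par e * sg (d + e) * d%:Z ^+ 2 * (par d - 1)) +
  (-1) * ds (fun d e => par e * sg (d + e) * (- sg d * (d%:Z ^+ 2 - d%:Z))) +
  ds (fun d e => - (sg (d + e) * d%:Z ^+ 2) * (e%:Z - par e)) +
  (-2) * ds (fun d e => par e * d%:Z ^+ 2 * (par e - 1)).
  rewrite -mulNr !dsumZ !dsumD; apply: eq_dsum => // d e _ _ <-.
  rewrite PoszM; parity.
rewrite -dA -dK -dK' -dL' A1 A2 B1 B2 B3 dL; lia.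
Qed.

End Convolutions.

(** * Truncated power series and logarithmic derivatives *)

Definition congX (R : nzRingType) (N : nat) (p q : {poly R}) : Prop :=
  forall i, (i <= N)%N -> p`_i = q`_i.

Section Congruence.
Variables (R : comNzRingType) (N : nat).
Implicit Types p q r : {poly R}.

Lemma congX_trans q p r : congX N p q -> congX N q r -> congX N p r.
Proof. by move=> h1 h2 i hi; rewrite h1 ?h2. Qed.

Lemma congX_sym p q : congX N p q -> congX N q p.
Proof. by move=> h i hi; rewrite h. Qed.

Lemma congXD p p' q q' :
  congX N p p' -> congX N q q' -> congX N (p + q) (p' + q').
Proof. by move=> h1 h2 i hi; rewrite !coefD h1 ?h2. Qed.

Lemma congXM p p' q q' :
  congX N p p' -> congX N q q' -> congX N (p * q) (p' * q').
Proof.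
move=> h1 h2 i hi; rewrite !coefM; apply: eq_bigr => j _.
by rewrite h1 ?h2 //; have := ltn_ord j; lia.
Qed.

Lemma congXMl p q r : congX N p q -> congX N (r * p) (r * q).
Proof. exact: congXM. Qed.

Lemma congXMr p q r : congX N p q -> congX N (p * r) (q * r).
Proof. by move=> h; apply: congXM. Qed.

Lemma congX_exp p q k : congX N p q -> congX N (p ^+ k) (q ^+ k).
Proof. by move=> h; elim: k => // k IH; rewrite !exprS; apply: congXM. Qed.

Lemma congX_Mxn (k : nat) p : (N < k)%N -> congX N (p * 'X^k) 0.
Proof. by move=> h i hi; rewrite coefMXn coef0 (leq_ltn_trans hi h). Qed.

(** A series with constant term 1 is invertible; an induction on the coefficients replaces the
    inverse. *)
Lemma congX_cancel p q r :
  r`_0 = 1 -> congX N (p * r) (q * r) -> congX N p q.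
Proof.
move=> r0 h.
suff H i : (i <= N)%N -> (p - q)`_i = 0.
  by move=> i hi; apply/eqP; rewrite -subr_eq0 -coefB H.
have [m] := ubnP i; elim: m i => // m IH i im iN.
have : ((p - q) * r)`_i = 0 by rewrite mulrBl coefB h // subrr.
rewrite coefM big_ord_recr /= subnn r0 mulr1 big1 ?add0r // => j _.
by rewrite IH ?mul0r //; have := ltn_ord j; lia.
Qed.

End Congruence.

(** [L] is the logarithmic derivative [q p' / p], written without division. *)
Definition log_deriv (N : nat) (p L : {poly int}) : Prop :=
  congX N ('X * p^`()) (p * L).

Section LogDeriv.
Variable N : nat.
Implicit Types p q L M : {poly int}.

Lemma log_deriv1 : log_deriv N 1 0.
Proof. by rewrite /log_deriv derivC !mulr0. Qed.

Lemma log_derivM p q L M :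
  log_deriv N p L -> log_deriv N q M -> log_deriv N (p * q) (L + M).
Proof.
move=> h1 h2; rewrite /log_deriv derivM mulrDr mulrA [in X in _ + X]mulrCA.
have -> : p * q * (L + M) = (p * L) * q + p * (q * M) by ring.
by apply: congXD; [apply: congXMr|apply: congXMl].
Qed.

Lemma log_deriv_exp p L k : log_deriv N p L -> log_deriv N (p ^+ k) (L *+ k).
Proof.
move=> h; elim: k => [|k IH]; first exact: log_deriv1.
by rewrite exprS mulrS; apply: log_derivM.
Qed.

Lemma coef_euler p i : ('X * p^`())`_i = p`_i *+ i.
Proof. by rewrite coefXM; case: i => //= i; rewrite coef_deriv. Qed.

(** As [L] has no constant term, the equation expresses [i p_i] through [p_0, ..., p_(i-1)].
    Cancelling [i] requires characteristic 0, so this is done over [int], before the reduction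
    modulo 5. *)
Lemma log_deriv_unique p q L : L`_0 = 0 -> p`_0 = q`_0 ->
  log_deriv N p L -> log_deriv N q L -> congX N p q.
Proof.
move=> L0 pq0 hp hq.
suff H i : (i <= N)%N -> (p - q)`_i = 0.
  by move=> i hi; apply/eqP; rewrite -subr_eq0 -coefB H.
have [m] := ubnP i; elim: m i => // m IH [|i] im iN.
  by rewrite coefB pq0 subrr.
have : (p - q)`_i.+1 *+ i.+1 = ((p - q) * L)`_i.+1.
  by rewrite mulrBl !coefB mulrnBl -hp // -hq // !coef_euler.
rewrite coefM big_ord_recr /= subnn L0 mulr0 addr0 big1 => [h|j _]; first by lia.
by rewrite IH ?mul0r //; have := ltn_ord j; lia.
Qed.

End LogDeriv.

(** * Lambert series, Euler products, and the identities for [F^4] and [G^2] *)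

Definition lambert (N : nat) (w : nat -> nat -> int) : {poly int} :=
  \sum_(p <- rect N) w p.1 p.2 *: 'X^(p.1 * p.2).

Lemma coef_lambert N w n : (lambert N w)`_n = dsum N n w.
Proof.
rewrite coef_sum /dsum [RHS]big_mkcond; apply: eq_bigr => p _.
by rewrite coefZ coefXn eq_sym; case: eqP => _; rewrite ?mulr1 ?mulr0.
Qed.

Lemma coef_lambertM N w w' n :
  (lambert N w * lambert N w')`_n =
  qsum N n (fun _ _ _ _ => true) (fun a x b y => w a x * w' b y).
Proof.
rewrite /qsum big_filter big_mkcond /= big_allpairs /lambert.
rewrite big_distrl coef_sum; apply: eq_bigr => p _ /=.
rewrite big_distrr coef_sum; apply: eq_bigr => q _ /=.
rewrite -scalerAl -scalerAr scalerA -exprD coefZ coefXn eq_sym.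
by case: eqP => _; rewrite ?mulr1 ?mulr0.
Qed.

Lemma coef0_lambert N w : (lambert N w)`_0 = 0.
Proof.
rewrite coef_lambert /dsum big_seq_cond big1 // => -[d e].
rewrite mem_rect /=; nia.
Qed.

Lemma lambertD N w w' :
  lambert N w + lambert N w' = lambert N (fun d e => w d e + w' d e).
Proof. by rewrite /lambert -big_split; apply: eq_bigr => p _; rewrite scalerDl. Qed.

Lemma lambertZ N c w : c *: lambert N w = lambert N (fun d e => c * w d e).
Proof.
by rewrite /lambert scaler_sumr; apply: eq_bigr => p _; rewrite scalerA.
Qed.

(** For [c = 1] and [c = -1] these are the truncated numerator and denominator of [F]. *)
Definition eulerprod (R : nzRingType) (N : nat) (c : R) : {poly R} :=
  \prod_(k <- iota 1 N) (1 - c *: 'X^k).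

Lemma coef0_eulerprod (R : comNzRingType) N (c : R) : (eulerprod N c)`_0 = 1.
Proof.
rewrite /eulerprod coef0_prod big_seq big1 // => k; rewrite mem_iota.
by case: k => // k _; rewrite coefB coef1 coefZ coefXn /= mulr0 subr0.
Qed.

Lemma log_deriv_euler_factor N k (c : int) : (0 < k)%N ->
  log_deriv N (1 - c *: 'X^k)
    (\sum_(j <- iota 1 N) - (c ^+ j * k%:Z) *: 'X^(k * j)).
Proof.
move=> k0.
(* The geometric series telescopes; besides the derivative it leaves a term of degree [k (m + 1)],
   which exceeds [N] when [m = N]. *)
have tele m : (1 - c *: 'X^k) *
    (\sum_(j <- iota 1 m) - (c ^+ j * k%:Z) *: 'X^(k * j)) =
    - (c * k%:Z) *: 'X^k + (c ^+ m.+1 * k%:Z) *: 'X^(k * m.+1) :> {poly int}.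
  elim: m => [|m IH].
    by rewrite big_nil mulr0 expr1 muln1 -scalerDl addNr scale0r.
  rewrite -[X in iota _ X]addn1 iotaD big_cat big_seq1 mulrDr IH add1n.
  rewrite [(k * m.+2)%N]mulnS exprD [c ^+ m.+2]exprS -!mul_polyC.
  rewrite !rmorphM !rmorphN !rmorphM; ring.
rewrite /log_deriv tele derivB derivC derivZ derivXn sub0r.
rewrite -[X in congX _ X _]addr0; apply: congXD; last first.
  by apply: congX_sym; rewrite -mul_polyC; apply: congX_Mxn; nia.
case: k k0 {tele} => // k _ i _ /=.
by rewrite mulrN -scalerAr mulrnAr -exprS scaleNr -scalerMnr scalerMnl -mulr_natr natz.
Qed.

Lemma log_deriv_eulerprod N (c : int) :
  log_deriv N (eulerprod N c) (lambert N (fun d e => - (c ^+ e * d%:Z))).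
Proof.
rewrite /lambert /rect big_allpairs /eulerprod /=.
have : all (ltn 0) (iota 1 N) by apply/allP => k; rewrite mem_iota => /andP[].
elim: {1 2 3}(iota 1 N) => [_|k s IH /= /andP[k0 /IH h]].
  by rewrite !big_nil; apply: log_deriv1.
by rewrite !big_cons; apply: log_derivM => //; apply: log_deriv_euler_factor.
Qed.

(** This is [q G' = - 8 S G], a multiple of [convolution_odd_sign] in each degree. *)
Lemma log_deriv_jacobi4 N :
  log_deriv N (1 - 8 *: lambert N (fun d e => sg (d + e) * d%:Z))
              (- 8 *: lambert N (fun d e => par e * d%:Z)).
Proof.
set T := lambert N _; set S := lambert N _.
rewrite /log_deriv derivB derivC derivZ sub0r => i iN.
rewrite mulrN -scalerAr coefN coefZ coef_euler.
rewrite mulrBl mul1r -scalerAr -scalerAl [T * S]mulrC coefB !coefZ coef_lambertM.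
have := convolution_odd_sign iN; rewrite /T /S !coef_lambert.
set q := qsum _ _ _ _; lia.
Qed.

(** The identity [F^4 = G] cleared of denominators; it is Jacobi's four-square theorem at [-q]. The
    logarithmic derivatives agree because [1 = (-1)^e + 2 par e]. *)
Lemma eulerprod_pow4 N :
  congX N (eulerprod N 1 ^+ 4)
    (eulerprod N (-1) ^+ 4 * (1 - 8 *: lambert N (fun d e => sg (d + e) * d%:Z))).
Proof.
apply: (log_deriv_unique (L := lambert N (fun d e => - (1 ^+ e * d%:Z)) *+ 4)).
- by rewrite coefMn coef0_lambert mul0rn.
- rewrite -!horner_coef0 horner_exp hornerM horner_exp !horner_coef0.
  rewrite !coef0_eulerprod coefB coefC coefZ coef0_lambert.
  by rewrite mulr0 subr0.
- exact/log_deriv_exp/log_deriv_eulerprod.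
have -> : lambert N (fun d e => - (1 ^+ e * d%:Z)) *+ 4 =
    lambert N (fun d e => - ((-1) ^+ e * d%:Z)) *+ 4 +
    (- 8 *: lambert N (fun d e => par e * d%:Z)).
  rewrite -!scaler_nat !lambertZ lambertD; apply: eq_bigr => -[d e] _ /=.
  by congr (_ *: _); rewrite expr1n; parity.
apply: log_derivM; last exact: log_deriv_jacobi4.
exact/log_deriv_exp/log_deriv_eulerprod.
Qed.

(** In [G^2 = 1 - 16 T + 64 T^2] the substitution [4 T^2 = Z + T] cancels the terms in [T]. *)
Lemma jacobi4_sqr N :
  congX N ((1 - 8 *: lambert N (fun d e => sg (d + e) * d%:Z)) ^+ 2)
          (1 + 16 *: lambert N (fun d e => sg d * d%:Z ^+ 3)).
Proof.
set T := lambert N _; set Z := lambert N _.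
have -> : (1 - 8 *: T) ^+ 2 = 1 - 16 *: T + 64 *: (T * T).
  by rewrite -!mul_polyC !rmorph_nat; ring.
move=> i iN; rewrite !coefD coefN !coefZ coef_lambertM.
have := convolution_sign_sign iN; rewrite /T /Z !coef_lambert.
set q := qsum _ _ _ _ => E; have -> : 64 * q = 16 * (4 * q) by ring.
rewrite E; ring.
Qed.

(** * The generating function of overpartitions *)

Section CountedBy.
Variable T : eqType.
Implicit Types (Q : pred (seq T)) (c : int).

(** The count is taken in [int] so that a coefficient of an integer polynomial can stand for [c];
    the witness list avoids any finite type of sequences. *)
Definition counted_by Q c : Prop :=
  exists L : seq (seq T), [/\ uniq L, L =i Q & (size L)%:Z = c].

Lemma eq_counted_by Q Q' c : Q =1 Q' -> counted_by Q c -> counted_by Q' c.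
Proof.
by move=> e [L [uL LQ sL]]; exists L; split=> // s; rewrite LQ unfold_in e.
Qed.

Lemma counted_by_pred0 : counted_by pred0 0.
Proof. by exists [::]. Qed.

Definition headed x Q : pred (seq T) :=
  fun s => if s is y :: s' then (y == x) && Q s' else false.

Lemma counted_by_headed x Q1 Q2 c1 c2 :
  (forall s, Q1 (x :: s) = false) -> counted_by Q1 c1 -> counted_by Q2 c2 ->
  counted_by (predU Q1 (headed x Q2)) (c1 + c2).
Proof.
move=> Q1x [L1 [u1 LQ1 <-]] [L2 [u2 LQ2 <-]].
exists (L1 ++ map (cons x) L2); split; last by rewrite size_cat size_map PoszD.
  rewrite cat_uniq u1 map_inj_uniq ?u2 ?andbT; last by move=> s t [].
  by apply/hasPn => s /mapP[t _ ->]; rewrite LQ1 unfold_in Q1x.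
move=> s; rewrite mem_cat LQ1 [RHS]unfold_in /= !unfold_in; congr orb.
case: s => [|y s] /=; first by apply/mapP => -[].
apply/mapP/andP => [[t tL [-> ->]]|[/eqP -> Qs]].
  by rewrite eqxx; move: tL; rewrite LQ2.
by exists s; rewrite ?LQ2.
Qed.

End CountedBy.

(** * Recursive description of overpartitions by their largest part *)

Fixpoint overlined_decreasing (s : seq (nat * bool)) : bool :=
  if s is x :: s' then
    all (fun y => (y.1 <= x.1)%N && (y.2 ==> (y.1 != x.1))) s' &&
    overlined_decreasing s'
  else true.

(** A position of the tail is a first occurrence in [x :: s] exactly when its part differs from
    [x.1] and it is a first occurrence in [s]. *)
Lemma overlined_decreasingE s : overlined_decreasing s =
  sorted geq (unzip1 s) &&
  all (fun i => nth false (unzip2 s) i ==>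
         (index (nth 0%N (unzip1 s) i) (unzip1 s) == i)) (iota 0 (size s)).
Proof.
elim: s => // x s IH.
have tr : transitive geq by move=> a b c /= h1 h2; apply: leq_trans h2 h1.
have -> : sorted geq (unzip1 (x :: s)) = path geq x.1 (unzip1 s) by [].
rewrite [LHS]/= IH path_sortedE //.
have -> : iota 0 (size (x :: s)) = 0%N :: map (addn 1) (iota 0 (size s)).
  by rewrite -iotaDl.
rewrite [X in _ = _ && X]/= eqxx implybT andTb all_map.
have -> : all (fun y => (y.1 <= x.1)%N && (y.2 ==> (y.1 != x.1))) s =
  all (geq x.1) (unzip1 s) &&
  all (fun i => nth false (unzip2 s) i ==> (nth 0%N (unzip1 s) i != x.1)) (iota 0 (size s)).
  rewrite all_predI [all (geq _) _]all_map; congr (_ && _).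
  rewrite -{1}(mkseq_nth (0%N, false) s) /mkseq all_map.
  apply: eq_in_all => i; rewrite mem_iota add0n => /andP[_ hi].
  by rewrite /= (nth_map (0%N, false)) // (nth_map (0%N, false)).
rewrite -!andbA; congr andb; rewrite andbCA; congr andb.
rewrite -all_predI; apply: eq_all => i /=; rewrite eq_sym.
by case: (nth false _ _) => //=; case: ifP.
Qed.

Definition opart (l m n : nat) (s : seq (nat * bool)) : bool :=
  [&& overlined_decreasing s,
      all (fun y => (0 < y.1 <= m)%N && ~~ (l %| y.1)%N) s &
      sumn (unzip1 s) == n].

(** Describes what may follow a copy of the part [m]: later copies of [m] cannot be overlined. *)
Definition opart_plain (l m n : nat) (s : seq (nat * bool)) : bool :=
  opart l m n s && all (fun y => y.2 ==> (y.1 != m)) s.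

Lemma mem_le_sumn (s : seq nat) (x : nat) : x \in s -> (x <= sumn s)%N.
Proof.
elim: s => //= y s IH; rewrite inE => /predU1P[->|/IH h]; first exact: leq_addr.
exact: leq_trans h (leq_addl _ _).
Qed.

Lemma opartE l m n s : (n <= m)%N ->
  opart l m n s =
  is_overpartition n s && all (fun p => ~~ (l %| p)%N) (unzip1 s).
Proof.
move=> nm; rewrite /opart /is_overpartition overlined_decreasingE.
have [sn|_] := eqVneq; last by rewrite ?andbF.
have -> : all (fun y : nat * bool => (0 < y.1 <= m)%N && ~~ (l %| y.1)%N) s =
    all (ltn 0) (unzip1 s) && all (fun p => ~~ (l %| p)%N) (unzip1 s).
  rewrite -all_predI all_map; apply: eq_in_all => y ys /=.
  rewrite (leq_trans _ nm) ?andbT // -sn; apply: mem_le_sumn.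
  by apply/mapP; exists y.
by rewrite andbT /= -!andbA; congr andb; rewrite andbCA.
Qed.

Lemma opart_cons_lt l m n k b s : (m < k)%N -> opart l m n ((k, b) :: s) = false.
Proof. by move=> mk; rewrite /opart /= [(k <= m)%N]leqNgt mk /= !andbF. Qed.

Lemma opart_cons_le l m n k b s : (k <= m)%N ->
  opart l m.+1 n ((k, b) :: s) = opart l m n ((k, b) :: s).
Proof.
move=> km; rewrite /opart /= km (leqW km).
case E : (all _ s) => //=; congr (_ && (_ && _ && _)).
apply: eq_in_all => y /(allP E) /andP[yk _].
by rewrite (leq_trans yk km) (leqW (leq_trans yk km)).
Qed.

Lemma opart_cons_max l m n b s : opart l m.+1 n ((m.+1, b) :: s) =
  ~~ (l %| m.+1)%N && ((m.+1 <= n)%N && opart_plain l m.+1 (n - m.+1) s).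
Proof.
rewrite /opart_plain /opart /= leqnn /=.
have -> : (m.+1 + sumn (unzip1 s) == n)%N =
          (m.+1 <= n)%N && (sumn (unzip1 s) == n - m.+1)%N by lia.
have -> : all (fun y : nat * bool => (y.1 <= m.+1)%N && (y.2 ==> (y.1 != m.+1))) s =
          all (fun y : nat * bool => (y.1 <= m.+1)%N) s &&
          all (fun y : nat * bool => y.2 ==> (y.1 != m.+1)) s by rewrite -all_predI.
set d := all (fun y : nat * bool => (0 < y.1 <= m.+1)%N && _) s.
set a := all (fun y : nat * bool => (y.1 <= m.+1)%N) s.
have : d ==> a.
  by apply/implyP => /allP h; apply/allP => y /h /andP[/andP[]].
by case: a; case: d; case: (all _ s); case: overlined_decreasing;
   case: (l %| _)%N; case: (_ < n)%N; case: eqP.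
Qed.

(** The cases are a first entry that is absent or below [m + 1], a plain copy of [m + 1], and an
    overlined one; both copies allow the same tails. *)
Lemma opart_rec l m n : ~~ (l %| m.+1)%N ->
  let Q s := (m.+1 <= n)%N && opart_plain l m.+1 (n - m.+1) s in
  opart l m.+1 n =1
  predU (predU (opart l m n) (headed (m.+1, false) Q)) (headed (m.+1, true) Q).
Proof.
move=> lm Q [|[k b] s] /=; rewrite ?orbF // !xpair_eqE.
case: (ltngtP k m.+1) => [km|km|->] /=; rewrite ?orbF.
- exact: opart_cons_le.
- by rewrite !opart_cons_lt // ltnW.
- by rewrite opart_cons_max lm opart_cons_lt //=; case: b; rewrite ?orbF.
Qed.

Lemma opart_plain_rec l m n : ~~ (l %| m.+1)%N ->
  opart_plain l m.+1 n =1
  predU (opart l m n)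
    (headed (m.+1, false)
       (fun s => (m.+1 <= n)%N && opart_plain l m.+1 (n - m.+1) s)).
Proof.
move=> lm [|[k b] s] /=; first by rewrite /opart_plain /= andbT orbF.
rewrite xpair_eqE {1}/opart_plain.
case: (ltngtP k m.+1) => [km|km|->]; rewrite ?orbF.
- rewrite opart_cons_le // ?andFb ?orbF; apply: andb_idr => /and3P[_ /allP E _].
  apply/allP => y /E /andP[/andP[_ ym] _].
  by rewrite neq_ltn ltnS ym implybT.
- by rewrite !opart_cons_lt // ltnW.
- rewrite opart_cons_max lm opart_cons_lt //= eqxx /=.
  case: b => /=; first by rewrite !andbF.
  rewrite /opart_plain; case: (all _ s); by rewrite ?andbF ?andbT.
Qed.

Definition regprod (R : nzRingType) (l m : nat) (c : R) : {poly R} :=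
  \prod_(k <- iota 1 m) (if (l %| k)%N then 1 else 1 - c *: 'X^k).

Lemma regprodS (R : nzRingType) (l m : nat) (c : R) :
  regprod l m.+1 c =
  regprod l m c * (if (l %| m.+1)%N then 1 else 1 - c *: 'X^(m.+1)).
Proof. by rewrite /regprod -[X in iota _ X]addn1 iotaD big_cat big_seq1 add1n. Qed.

(** Induction on the bound [m]. Nothing changes if [l] divides [m + 1]. Otherwise, with
    [Y = X^(m + 1)] and [C0] the series for [m], [opart_plain] has the series [C1 = C0 / (1 - Y)]
    and [opart] has [C0 + 2 C1 Y = C0 (1 + Y) / (1 - Y)]. *)
Lemma opart_genfun l N m : exists2 C : {poly int},
  (forall n, (n <= N)%N -> counted_by (opart l m n) C`_n) &
  congX N (C * regprod l m 1) (regprod l m (-1)).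
Proof.
elim: m => [|m [C0 cC0 hC0]].
  exists 1; last by rewrite /regprod !big_nil mulr1.
  have op0 n k b s : opart l 0 n ((k, b) :: s) = false.
    by case: k => [|k]; [rewrite /opart /= !andbF|rewrite opart_cons_lt].
  move=> n _; rewrite coef1; case: n => [|n].
    exists [:: [::]]; split=> // -[|[k b] s]; first by rewrite inE.
    by rewrite inE [RHS]unfold_in -/(opart _ _ _ _) op0.
  apply: (@eq_counted_by _ pred0); last exact: counted_by_pred0.
  by move=> -[|[k b] s] //=; rewrite op0.
have [lm|lm] := boolP (l %| m.+1)%N.
  exists C0; last by rewrite !regprodS lm !mulr1.
  move=> n /cC0; apply: eq_counted_by => s; case: s => // -[k b] s.
  case: (ltngtP k m.+1) => [km|km|->].
  - by rewrite opart_cons_le.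
  - by rewrite !opart_cons_lt // ltnW.
  - by rewrite opart_cons_max lm opart_cons_lt.
pose Y : {poly int} := 'X^(m.+1).
(* A finite geometric sum stands for [1 / (1 - Y)]; the error starts in degree [(m + 1) (N + 1)],
   above [N]. *)
pose C1 : {poly int} := C0 * \sum_(i < N.+1) Y ^+ i.
have hC1 : congX N (C1 * (1 - Y)) C0.
  have -> : C1 * (1 - Y) = C0 - C0 * 'X^(m.+1 * N.+1).
    rewrite /C1 exprM -/Y -mulrA -[1 - Y]opprB mulrN [_ * (Y - 1)]mulrC -subrX1.
    ring.
  rewrite -[X in congX _ _ X]addr0; apply: congXD => // i iN.
  by rewrite coefN (@congX_Mxn _ N) ?coef0 ?oppr0 // mulSn; lia.
have cC1 n : (n <= N)%N -> counted_by (opart_plain l m.+1 n) C1`_n.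
  have [k] := ubnP n; elim: k n => // k IH n nk nN.
  (* The relation [C1 = C0 + C1 Y] matches [opart_plain_rec] term by term. *)
  have -> : C1`_n = C0`_n + (C1 * Y)`_n.
    by rewrite -hC1 // mulrBr mulr1 coefB subrK.
  apply: eq_counted_by (fun s => esym (opart_plain_rec n lm s)) _.
  apply: counted_by_headed; [by move=> s; apply: opart_cons_lt|exact: cC0|].
  rewrite coefMXn; case: (ltnP n m.+1) => h; last first.
      apply: (@eq_counted_by _ (opart_plain l m.+1 (n - m.+1))) => //.
      by apply: IH; lia.
  by apply: (@eq_counted_by _ pred0); last exact: counted_by_pred0.
exists (C0 + C1 * Y + C1 * Y).
  move=> n nN; rewrite !coefD.
  have cQ : counted_by (fun s => (m.+1 <= n)%N && opart_plain l m.+1 (n - m.+1) s)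
              (C1 * Y)`_n.
    rewrite coefMXn; case: (ltnP n m.+1) => h; last first.
      apply: (@eq_counted_by _ (opart_plain l m.+1 (n - m.+1))) => //.
      by apply: cC1; lia.
    by apply: (@eq_counted_by _ pred0); last exact: counted_by_pred0.
  apply: eq_counted_by (fun s => esym (opart_rec n lm s)) _.
  apply: counted_by_headed => //.
    by move=> s /=; rewrite opart_cons_lt //= xpair_eqE andbF.
  apply: counted_by_headed => //; first by move=> s; apply: opart_cons_lt.
  exact: cC0.
rewrite !regprodS (negbTE lm) scale1r scaleN1r opprK -/Y.
apply: congX_trans (_ : congX N _ (C0 * regprod l m 1 * (1 + Y))) _; last exact: congXMr.
have -> : (C0 + C1 * Y + C1 * Y) * (regprod l m 1 * (1 - Y)) =
  (C0 * (1 - Y) + (C1 * (1 - Y)) * (2 * Y)) * regprod l m 1 by ring.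
have -> : C0 * regprod l m 1 * (1 + Y) =
  (C0 * (1 - Y) + C0 * (2 * Y)) * regprod l m 1 by ring.
by apply/congXMr/congXD => //; apply: congXMr.
Qed.

Lemma Abar_counted l m n c :
  (n <= m)%N -> counted_by (opart l m n) c -> (Abar l n)%:Z = c.
Proof.
move=> nm [L [uL LQ <-]]; congr Posz.
rewrite /Abar cardE -(size_map (@op_val n)); apply/perm_size/uniq_perm => //.
  by rewrite (map_inj_uniq (@op_val_inj n)) enum_uniq.
move=> s; rewrite LQ -[RHS]/(opart l m n s) opartE //; apply/mapP/andP.
  by move=> [t]; rewrite mem_enum !inE => /andP[h1 h2] ->.
move=> [h1 h2]; have [t tO ts] := op_val_surj h1.
by exists t; rewrite ?ts // mem_enum inE tO ts.
Qed.

(** * Reduction modulo 5 *)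

Lemma congX_prod (R : comNzRingType) N (s : seq nat) (F G : nat -> {poly R}) :
  (forall k, congX N (F k) (G k)) ->
  congX N (\prod_(k <- s) F k) (\prod_(k <- s) G k).
Proof.
by move=> h; elim: s => [|k s IH]; rewrite ?big_nil ?big_cons //; apply: congXM.
Qed.

Lemma congX_map (R S : comNzRingType) (f : {rmorphism R -> S}) N p q :
  congX N p q -> congX N (map_poly f p) (map_poly f q).
Proof. by move=> h i iN; rewrite !coef_map /= h. Qed.

Lemma coef_mul_sparse (R : comNzRingType) (k n : nat) (p q : {poly R}) :
  (0 < k)%N ->
  ((p \Po 'X^k) * q)`_(k * n) = \sum_(j < n.+1) p`_j * q`_(k * (n - j)).
Proof.
move=> k0; rewrite coefM .
rewrite -(big_mkord xpredT (fun i => (p \Po 'X^k)`_i * q`_(k * n - i))).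
rewrite -(big_mkord xpredT (fun j => p`_j * q`_(k * (n - j)))).
rewrite (bigID (fun i => k %| i)%N) /= [X in _ + X]big1 ?addr0; last first.
  by move=> i /negbTE ki; rewrite coef_comp_poly_Xn // ki mul0r.
apply: (big_seq_bij (fun i => i %/ k)%N (fun j => k * j)%N);
  rewrite ?iota_uniq // => i; rewrite !mem_index_iota /= => hi.
  move=> ki; rewrite coef_comp_poly_Xn // ki; split=> //.
  - rewrite ltnS leq_divLR //; lia.
  - by rewrite mulnC divnK.
  - by rewrite mulnBr [(k * (i %/ k))%N]mulnC divnK.
move=> _; rewrite dvdn_mulr // mulKn //; split=> //; nia.
Qed.

Lemma pchar_poly_F5 : 5 \in [pchar {poly 'F_5}].
Proof.
by rewrite inE /= -polyC_natr; apply/eqP; rewrite -[0]/(0%:P); congr _%:P; apply/eqP.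
Qed.

Lemma F5_exp5 (c : 'F_5) : c ^+ 5 = c.
Proof. by apply/val_inj; case: c => -[|[|[|[|[|k]]]]]. Qed.

(** The Frobenius map is additive and fixes the scalars. *)
Lemma poly_F5_exp5 (p : {poly 'F_5}) : p ^+ 5 = p \Po 'X^5.
Proof.
elim/poly_ind: p => [|p c IH]; first by rewrite expr0n comp_poly0.
rewrite comp_polyD comp_polyM comp_polyX comp_polyC -IH.
rewrite exprDn_pchar; last by apply/(pi_pnat _ pchar_poly_F5).
by rewrite exprMn -polyC_exp F5_exp5.
Qed.

Lemma eulerprod_F5_exp25 N (c : 'F_5) :
  eulerprod N c ^+ 25 = \prod_(k <- iota 1 N) (1 - c *: 'X^(25 * k)).
Proof.
have frob k : (1 - c *: 'X^k) ^+ 5 = 1 - c *: 'X^(5 * k).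
  rewrite poly_F5_exp5 comp_polyB comp_polyZ comp_Xn_poly -exprM.
  by rewrite -[X in X \Po _]/(1%:P) comp_polyC.
rewrite /eulerprod -prodrXl; apply: eq_bigr => k _.
by rewrite -[X in _ ^+ X = _]/(5 * 5)%N exprM !frob mulnA.
Qed.

(** By Frobenius the 25th power supplies the factors whose index is a multiple of 25, which are the
    ones missing from [regprod]; factors of index above [N] are 1 modulo [X^(N + 1)]. *)
Lemma eulerprod_regprod N (c : 'F_5) :
  congX N (regprod 25 N c * eulerprod N c ^+ 25) (eulerprod N c).
Proof.
rewrite eulerprod_F5_exp25.
have -> : eulerprod N c = regprod 25 N c *
    \prod_(k <- iota 1 N) (if (25 %| k)%N then 1 - c *: 'X^k else 1).
  rewrite -big_split; apply: eq_bigr => k _ /=.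
  by case: ifP; rewrite ?mulr1 ?mul1r.
apply: congXMl.
apply: (congX_trans (q := \prod_(k <- iota 1 N)
          (if (25 * k <= N)%N then 1 - c *: 'X^(25 * k) else 1))).
  apply: congX_prod => k; case: leqP => // h.
  rewrite -[X in congX _ _ X]addr0; apply: congXD => // i iN.
  by rewrite coefN -mul_polyC (congX_Mxn _ h) // coef0 oppr0.
rewrite -!big_mkcond.
have -> : \prod_(k <- iota 1 N | (25 * k <= N)%N) (1 - c *: 'X^(25 * k)) =
          \prod_(k <- iota 1 N | (25 %| k)%N) (1 - c *: 'X^k).
  apply: (big_seq_bij (fun k => 25 * k)%N (fun k => k %/ 25)%N);
    rewrite ?iota_uniq // => k; rewrite !mem_iota.
    by move=> h1 h2; rewrite mulKn // dvdn_mulr //; split=> //; lia.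
  by move=> h1 h2; rewrite [(25 * _)%N]mulnC divnK //; split=> //; lia.
by [].
Qed.

(** Terms with 5 dividing [d] vanish modulo 5. In the others [d e = 5 m] forces [e = 5 e'], and
    replacing [e] by [e'] keeps the sign because 5 is odd. *)
Lemma dsum_5M N m : (5 * m <= N)%N ->
  (dsum N (5 * m) (fun d e => sg (d + e) * d%:Z))%:~R =
  (dsum N m (fun d e => sg (d + e) * d%:Z))%:~R :> 'F_5.
Proof.
move=> mN; rewrite /dsum !rmorph_sum /=.
have z d e : (5 %| d)%N -> (sg (d + e) * d%:Z)%:~R = 0 :> 'F_5.
  move=> h; rewrite rmorphM /= -[(Posz d)%:~R]/(d%:R).
  by rewrite -(divnK h) natrM (_ : 5%:R = 0) ?mulr0 //; apply/eqP.
rewrite (bigID (fun p : nat * nat => 5 %| p.1)%N) /= big1 ?add0r; last first.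
  by move=> [d e] /andP[_ h]; apply: z.
rewrite [RHS](bigID (fun p : nat * nat => 5 %| p.1)%N) /= [X in X + _]big1 ?add0r; last first.
  by move=> [d e] /andP[_ h]; apply: z.
symmetry.
apply: (big_seq_bij (fun p => (p.1, 5 * p.2)%N) (fun p => (p.1, p.2 %/ 5)%N));
  rewrite ?rect_uniq // => -[d e]; rewrite /= !mem_rect.
  move=> h1 /andP[/eqP h2 h3]; rewrite h3 mulKn //; split=> //; try nia.
  congr (_ * _)%:~R; rewrite -[LHS]signr_odd -[RHS]signr_odd.
  by rewrite (oddD d (5 * e)) oddM oddD.
move=> h1 /andP[/eqP h2 h3].
have h5 : (5 %| e)%N.
  have : (5 %| d * e)%N by rewrite h2 dvdn_mulr.
  by rewrite Euclid_dvdM // (negbTE h3).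
rewrite h3 [(5 * (e %/ 5))%N]mulnC divnK //; split=> //.
  have : (e %/ 5 <= e)%N by apply: leq_div.
  have := divnK h5; nia.
rewrite andbT; apply/eqP; have := divnK h5; nia.
Qed.

Lemma sigma3mE N n : (0 < n <= N)%N ->
  sigma3m n = dsum N n (fun d e => sg d * d%:Z ^+ 3).
Proof.
move=> /andP[n0 nN]; symmetry.
apply: (big_seq_bij (fun p => p.1) (fun d => (d, n %/ d)%N)).
- exact: rect_uniq.
- exact: divisors_uniq.
- move=> [d e] /=; rewrite mem_rect => h /eqP de.
  rewrite -dvdn_divisors // -de dvdn_mulr // mulKn //; lia.
move=> d; rewrite -dvdn_divisors // => dn _; have := divnK dn.
rewrite mem_rect /= mulnC => e; split=> //; last exact/eqP.
have := dvdn_leq n0 dn; nia.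
Qed.

Lemma map_eulerprod (R S : comNzRingType) (f : {rmorphism R -> S}) N c :
  map_poly f (eulerprod N c) = eulerprod N (f c).
Proof.
rewrite /eulerprod rmorph_prod; apply: eq_bigr => k _ /=.
by rewrite rmorphB rmorph1 /= map_polyZ map_polyXn.
Qed.

Lemma map_regprod (R S : comNzRingType) (f : {rmorphism R -> S}) l N c :
  map_poly f (regprod l N c) = regprod l N (f c).
Proof.
rewrite /regprod rmorph_prod; apply: eq_bigr => k _ /=; case: ifP => _.
  by rewrite rmorph1.
by rewrite rmorphB rmorph1 /= map_polyZ map_polyXn.
Qed.

(** In the notation of the proof, [r = D / D^25] and [r' = E / E^25], so
    [P = r' / r = (D / E)^24 = F^24 = G^6]. *)
Lemma opart25_genfun (N : nat) (C : {poly int}) (f : {rmorphism int -> 'F_5}) :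
  congX N (C * regprod 25 N 1) (regprod 25 N (-1)) ->
  congX N (map_poly f C) (map_poly f
    (1 - 8 *: lambert N (fun d e => sg (d + e) * d%:Z)) ^+ 6).
Proof.
move=> /(congX_map f); rewrite rmorphM /= !map_regprod rmorphN rmorph1.
have := congX_map f (@eulerprod_pow4 N).
rewrite rmorphXn rmorphM rmorphXn /= !map_eulerprod rmorphN rmorph1.
set G := map_poly f (1 - _); set P := map_poly f C.
set D := eulerprod N 1; set E := eulerprod N (-1).
set r := regprod _ _ 1; set r' := regprod _ _ (-1) => hG hP.
have D0 : D`_0 = 1 by apply: coef0_eulerprod.
have E0 : E`_0 = 1 by apply: coef0_eulerprod.
have h1 : congX N (P * E ^+ 24) (D ^+ 24).
  (* The factor [D E] raises the exponents 24 to 25, so that [eulerprod_regprod] applies to both [D]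
     and [E]. *)
  apply: (congX_cancel (r := D * E)); first by rewrite coef0M D0 E0 mulr1.
  have -> : P * E ^+ 24 * (D * E) = P * E ^+ 25 * D by ring.
  apply: (congX_trans (q := P * E ^+ 25 * (r * D ^+ 25))).
    by apply/congXMl/congX_sym/eulerprod_regprod.
  have -> : P * E ^+ 25 * (r * D ^+ 25) = P * r * (E ^+ 25 * D ^+ 25) by ring.
  apply: (congX_trans (q := r' * (E ^+ 25 * D ^+ 25))); first exact: congXMr.
  have -> : D ^+ 24 * (D * E) = E * D ^+ 25 by ring.
  by rewrite mulrA; apply/congXMr/eulerprod_regprod.
apply: (congX_cancel (r := E ^+ 24)).
  by rewrite -horner_coef0 horner_exp horner_coef0 E0 expr1n.
apply: congX_trans h1 _.
have -> : D ^+ 24 = (D ^+ 4) ^+ 6 by rewrite -exprM.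
have -> : G ^+ 6 * E ^+ 24 = (E ^+ 4 * G) ^+ 6 by ring.
exact: congX_exp.
Qed.

Lemma Abar25_F5 (n : nat) : (0 < n)%N ->
  ((Abar 25 (5 * n))%:Z)%:~R = (sigma3m n)%:~R :> 'F_5.
Proof.
move=> hn; pose N := (5 * n)%N.
have [C cC gC] := opart_genfun 25 N N.
rewrite (Abar_counted (leqnn _) (cC N (leqnn _))).
rewrite (@sigma3mE N) ?hn /=; last by rewrite /N; lia.
pose f : {rmorphism int -> 'F_5} := intr.
rewrite -[LHS](coef_map f) (opart25_genfun _ gC) //.
set G := map_poly f _.
have G5 m : (m <= n)%N -> G`_(5 * m) = G`_m.
  move=> mn; rewrite !coef_map /= !coefB !coef1 !coefZ !coef_lambert.
  rewrite !rmorphB !rmorphM /= dsum_5M ?leq_mul2l //; congr ((_%:R)%:~R - _).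
  lia.
(* With [G^6 = G(X^5) G], the coefficient of index [5 n] is the sum of the
   [G_j G_(5 (n - j)) = G_j G_(n - j)], which is the coefficient of index [n] in [G^2]. *)
rewrite exprSr poly_F5_exp5 coef_mul_sparse //.
under eq_bigr => j _ do rewrite G5 ?leq_subr //.
rewrite -coefM -expr2 -rmorphXn coef_map /= jacobi4_sqr; last by rewrite /N; lia.
(* The constant term of [1 + 16 Z] does not contribute as [n > 0], and 16 is 1 modulo 5. *)
rewrite coefD coefZ coef1 coef_lambert (gtn_eqF hn) add0r rmorphM /=.
rewrite (_ : 16%:~R = 1) ?mul1r //; exact/eqP.
Qed.

Local Close Scope ring_scope.

Theorem theorem5 (n : nat) (hn : 0 < n) :
  ((Abar 25 (5 * n)%N)%:Z = sigma3m n %[mod 5%:Z])%Z.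
Proof.
apply/eqP; rewrite eqz_mod_dvd (dvdz_pcharf (pchar_Fp _)) // rmorphB subr_eq0.
exact/eqP/Abar25_F5.
Qed.
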